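(* Let $p\ge 3$ be a prime, let $\alpha\in[0,\infty]$, and let $X_1,\dots,X_n$ be independent random variables taking values in $\mathbb{Z}/p\mathbb{Z}$. For each $i$, suppose that the probability mass function $f_i$ of $X_i$ is either $\triangle$-regular or $\square$-regular, and that $f_i$ itself is the same as either $f_i^*$ (in the $\triangle$-regular case), $f_i^+$, or $f_i^-$. If $S_{\mathbf a}=a_1X_1+\cdots+a_nX_n$ (computed in $\mathbb{Z}/p\mathbb{Z}$), where $\mathbf{a}=(a_1,\dots,a_n)\in\mathbb{Z}^n\setminus\{\mathbf 0\}$, then $$H_\alpha(S_{\mathbf a})\ \ge\ H_\alpha(X_1+\cdots+X_n).$$
   Context: $\mathbb{R}_+$ denotes the nonnegative reals, $\mathbf 0$ is the zero vector of $\mathbb{Z}^n$, and $\mathbb{Z}/p\mathbb{Z}$ is identified with the representatives $\{-\frac{p-1}{2},\dots,0,\dots,\frac{p-1}{2}\}$; sums of random variables on $\mathbb{Z}/p\mathbb{Z}$ are taken modulo $p$. Rearrangements: for $f:\mathbb{Z}/p\mathbb{Z}\to\mathbb{R}_+$, $f^+$ is the function having the same values as $f$ with the same multiplicities, arranged so that $f^+(0)\ge f^+(1)\ge f^+(-1)\ge f^+(2)\ge f^+(-2)\ge\cdots\ge f^+(\frac{p-1}{2})\ge f^+(-\frac{p-1}{2})$. Likewise $f^-$ is arranged so that $f^-(0)\ge f^-(-1)\ge f^-(1)\ge\cdots\ge f^-(-\frac{p-1}{2})\ge f^-(\frac{p-1}{2})$. $f$ is $\triangle$-regular if $f^+(z)=f^-(z)$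 for all $z\in\mathbb{Z}/p\mathbb{Z}$; in that case $f^*:=f^+=f^-$. $f$ is $\square$-regular if either $f\equiv 0$, or $|\mathrm{supp} f|$ is even and $f^+(z+1)=f^-(z)$ for all $z\in\mathbb{Z}/p\mathbb{Z}$. Rényi entropy of a random variable $X$ on $\mathbb{Z}/p\mathbb{Z}$ with probability mass function $f$: $H_\alpha(X)=\frac{1}{1-\alpha}\log\sum_i f(i)^\alpha$ for $\alpha\in(0,1)\cup(1,\infty)$, $H_0(X)=\log|\mathrm{supp}(f)|$, $H_1(X)=-\sum_i f(i)\log f(i)$ (with $0\log 0=0$), $H_\infty(X)=-\log\max_i f(i)$.
   Formalization: The condition that a is a nonzero integer vector is strengthened to: no coefficient a_i is divisible by p. Otherwise the claim fails, e.g. n=1, p=3, a=(3), X_1 uniform on {0,1}, α=0. *)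

(* Defs.v *)
From HB Require Import structures.
From mathcomp Require Import all_boot all_order all_algebra.
From mathcomp Require Import all_classical all_reals all_analysis.

Set Implicit Arguments.
Unset Strict Implicit.
Unset Printing Implicit Defensive.

Import Order.TTheory GRing.Theory Num.Theory.
Import numFieldNormedType.Exports.

Local Open Scope classical_set_scope.
Local Open Scope ring_scope.

(* For p prime, Z/pZ is 'F_p; as a type 'F_p is an ordinal 'I_k.+2, so these
   instances equip it with the sigma-algebra of all its subsets. *)
HB.instance Definition _ (n : nat) := isPointed.Build 'I_n.+1 ord0.

HB.instance Definition _ (n : nat) :=
  @isMeasurable.Build default_measure_display 'I_n.+1
    discrete_measurable discrete_measurable0
    discrete_measurableC discrete_measurableU.

Section Independence.
Context {d d' : measure_display} {T : measurableType d}
  {T' : measurableType d'} {R : realType}.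

Definition mutually_independent (P : probability T R) (n : nat)
    (X : 'I_n -> T -> T') : Prop :=
  forall (J : {set 'I_n}) (B : 'I_n -> set T'),
    (forall i, i \in J -> measurable (B i)) ->
    P (\bigcap_(i in [set` J]) (X i @^-1` B i)) =
    (\prod_(i in J) P (X i @^-1` B i))%E.

End Independence.

Section Rearrangements.
Context {R : realType} (p : nat).
Implicit Types f : 'F_p -> R.

(* 0, 1, -1, 2, -2, ..., (p-1)/2, -(p-1)/2 *)
Definition order_plus : seq 'F_p :=
  0 :: flatten [seq [:: j%:R; - j%:R] | j <- iota 1 p.-1./2].

(* 0, -1, 1, -2, 2, ..., -(p-1)/2, (p-1)/2 *)
Definition order_minus : seq 'F_p :=
  0 :: flatten [seq [:: - j%:R; j%:R] | j <- iota 1 p.-1./2].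

Definition values_decr f : seq R := sort >=%O [seq f z | z : 'F_p].

(* f^+, f^-: the k-th largest value of f is placed at the k-th point of the
   corresponding order. *)
Definition rearr_plus f (z : 'F_p) : R :=
  nth 0 (values_decr f) (index z order_plus).

Definition rearr_minus f (z : 'F_p) : R :=
  nth 0 (values_decr f) (index z order_minus).

Definition support_set f : {set 'F_p} := [set z | f z != 0].

Definition triangle_regular f : Prop :=
  forall z, rearr_plus f z = rearr_minus f z.

(* Only meaningful when f is triangle-regular. *)
Definition rearr_star f : 'F_p -> R := rearr_plus f.

Definition square_regular f : Prop :=
  (forall z, f z = 0) \/
  (~~ odd #|support_set f| /\
   forall z, rearr_plus f (z + 1) = rearr_minus f z).

End Rearrangements.

Section RenyiEntropy.
Context {R : realType} (p : nat).

(* The Renyi entropy of order alpha of the probability mass function f, with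
   the natural logarithm. Conventions of the library: ln 0 = 0, so that
   0 * ln 0 = 0, and 0 `^ a = 0 for a != 0. The order -oo is irrelevant. *)
Definition pmf_renyi (alpha : \bar R) (f : 'F_p -> R) : R :=
  match alpha with
  | a%:E =>
      if a == 0 then ln (#|support_set f|%:R)
      else if a == 1 then - \sum_(z : 'F_p) f z * ln (f z)
      else (1 - a)^-1 * ln (\sum_(z : 'F_p) f z `^ a)
  | +oo%E => - ln (\big[Order.max/0]_(z : 'F_p) f z)
  | -oo%E => 0
  end.

Context {d : measure_display} {T : measurableType d}.

Definition pmf_Zp (P : probability T R) (X : T -> 'F_p) (z : 'F_p) : R :=
  fine (P (X @^-1` [set z])).

Definition renyi_entropy (P : probability T R) (alpha : \bar R)
    (X : T -> 'F_p) : R :=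
  pmf_renyi alpha (pmf_Zp P X).

End RenyiEntropy.

(* Main.v *)
Require Import Defs.
From mathcomp Require Import all_boot all_order all_algebra.
From mathcomp Require Import all_classical all_reals all_analysis.
From mathcomp Require Import zify ring lra.

(* A square-regular function is, up to a sign, an additive constant and a
   translation, a triangle-regular one, because the complement in Z/pZ of an
   interval of even size is an interval of odd size. So all the convolutions
   that occur are, up to these operations, convolutions of nonnegative
   combinations t of indicators of centered intervals [-r, r].

   Let I_k be the centered interval of size k. If the sum of f over every set C
   is at most G(|C|), then Pollard's inequality holds for f: the sum of f(x + y)
   over x in B, y in C is at most the value pollard_bound G |B| |C| attained by
   intervals. This follows from Dyson's transform (B, C) -> (B :&: C, B :|: C),
   under which the bound splits exactly. With G(k) the sum of g over I_k, it
   gives by induction on the number of factors that the sum over C of the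
   dilated convolution is at most the sum over I_|C| of the undilated one.
   Hence the law of S_a is majorized by a translate of the law of the sum, and
   Renyi entropies are Schur-concave. *)

Set Implicit Arguments.
Unset Strict Implicit.
Unset Printing Implicit Defensive.

Import Order.TTheory GRing.Theory Num.Theory.
Import numFieldNormedType.Exports.

Local Open Scope ring_scope.

(** * Pollard's inequality in Z/pZ *)

(** For b, c <= p, the multiset of sums x + y of two runs of sizes b and c consists of [b + c - p]
    copies of Z/pZ, due to wrap-around, and of nested runs whose lengths decrease by 2; each is
    charged [G] of its size. *)
Definition pollard_bound (R : nmodType) (p : nat) (G : nat -> R) (b c : nat) : R :=
  \sum_(0 <= j < minn b c)
    (if (j < b + c - p)%N then G p else G ((b + c).-1 - j.*2)%N).

Lemma pollard_boundC (R : nmodType) (p : nat) (G : nat -> R) (b c : nat) :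
  pollard_bound p G b c = pollard_bound p G c b.
Proof. by rewrite /pollard_bound minnC addnC. Qed.

(** Passing from (b, c) to (i, b + c - i) keeps b + c, hence the first i terms; shifting j by i
    turns the others into the terms for (b - i, c - i). By [b + c - i <= p] all wrapped terms are
    among the first i. *)
Lemma pollard_bound_split (R : nmodType) (p : nat) (G : nat -> R) (b c i : nat) :
  (i <= b <= c)%N -> (b + c - i <= p)%N ->
  pollard_bound p G b c =
  pollard_bound p G i (b + c - i) + pollard_bound p G (b - i) (c - i).
Proof.
move=> /andP[ib bc] bcip; rewrite /pollard_bound.
have -> : minn b c = b by apply/minn_idPl.
have -> : minn i (b + c - i) = i by apply/minn_idPl; lia.
have -> : minn (b - i) (c - i) = (b - i)%N by apply/minn_idPl; lia.
rewrite (big_cat_nat (n := i)) //=; congr (_ + _).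
  by rewrite subnKC //; lia.
rewrite -{1}[i]add0n big_addn; apply: eq_bigr => j _.
have -> : (j + i < b + c - p)%N = false by lia.
have -> : (j < b - i + (c - i) - p)%N = false by lia.
by congr G; lia.
Qed.

(** As p is prime, d generates the additive group of Z/pZ. *)
Lemma addr_stable_setT (p : nat) (C : {set 'F_p}) (d : 'F_p) :
  prime p -> d != 0 -> C != finset.set0 -> (forall y, y \in C -> d + y \in C) ->
  C = finset.setT.
Proof.
move=> p_pr d0 /finset.set0Pn[y yC] Cd; apply/setP => z; rewrite inE.
have Cn n : n%:R * d + y \in C.
  elim: n => [|n IH]; first by rewrite mul0r add0r.
  by rewrite -natr1 mulrDl mul1r [_ + d]addrC -addrA Cd.
have := Cn ((z - y) / d : 'F_p); rewrite natr_Zp -mulrA mulVf // mulr1.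
by rewrite subrK.
Qed.

(* Dyson's transform: the part it drops is again the same sum for a smaller
   pair of sets, so that the induction applies to both terms. *)
Lemma sum_setI_setU (V : finZmodType) (R : zmodType) (f : V -> R)
    (B C : {set V}) :
  \sum_(x in B) \sum_(y in C) f (x + y) =
  \sum_(x in B :&: C) \sum_(y in B :|: C) f (x + y) +
  \sum_(x in B :\: C) \sum_(y in C :\: B) f (x + y).
Proof.
have sumU (F : V -> R) : \sum_(y in B :|: C) F y =
    \sum_(y in C) F y + \sum_(y in B :\: C) F y.
  rewrite (big_setID C) /= finset.setIUl finset.setIid finset.setDUl.
  rewrite finset.setDv finset.setU0.
  by rewrite (finset.setUidPr (finset.subsetIr B C)).
have sumC (F : V -> R) : \sum_(y in C) F y =
    \sum_(y in B :&: C) F y + \sum_(y in C :\: B) F y.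
  by rewrite (big_setID B) /= finset.setIC.
rewrite (big_setID C) /=.
under [X in _ = X + _]eq_bigr do rewrite sumU.
rewrite big_split /= -addrA; congr (_ + _).
under eq_bigr do rewrite sumC.
rewrite big_split /=; congr (_ + _); rewrite exchange_big /=.
by apply: eq_bigr => x _; apply: eq_bigr => y _; rewrite addrC.
Qed.

Lemma sum_translate (V : finZmodType) (R : nmodType) (f : V -> R) (C : {set V}) e :
  \sum_(y in C) f (e + y) = \sum_(y in [set e + y | y in C]) f y.
Proof. by rewrite big_imset //= => x y _ _; apply: addrI. Qed.

(** Induction on the smaller cardinality, for all f at once because translating C changes f. Dyson's
    transform is applied to B and a translate of C that meets B in a nonempty proper subset of B, so
    both resulting pairs are smaller. *)
Lemma sum_set_pollard (R : numDomainType) (p : nat) (G : nat -> R)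
    (f : 'F_p -> R) (B C : {set 'F_p}) :
  prime p -> (forall D : {set 'F_p}, \sum_(x in D) f x <= G #|D|) ->
  \sum_(x in B) \sum_(y in C) f (x + y) <= pollard_bound p G #|B| #|C|.
Proof.
move=> p_pr.
have [n] := ubnP (minn #|B| #|C|); elim: n => // n IH in f B C *.
wlog BC : B C / (#|B| <= #|C|)%N => [hwlog|].
  have /orP[|CB] := leq_total #|B| #|C|; first exact: hwlog.
  move=> ltn domf; rewrite pollard_boundC exchange_big /=.
  under eq_bigr do under eq_bigr do rewrite addrC.
  by apply: hwlog domf; rewrite // minnC.
rewrite (minn_idPl BC) => ltn domf.
have Cp : (#|C| <= p)%N by rewrite -[p in leqRHS]card_Fp // max_card.
have domf_tr e (D : {set 'F_p}) : \sum_(y in D) f (e + y) <= G #|D|.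
  by rewrite sum_translate (le_trans (domf _)) // card_imset //; apply: addrI.
have [B0|B0] := posnP #|B|.
  by rewrite B0 /pollard_bound min0n big_geq // (cards0_eq B0) big_set0.
(* If C is everything, all the terms of the bound are wrapped ones. *)
have [Ceq|Cneq] := eqVneq #|C| p.
  have -> : pollard_bound p G #|B| #|C| = \sum_(x in B) G p.
    rewrite /pollard_bound (minn_idPl BC) Ceq addnK.
    rewrite sumr_const -[in RHS](subn0 #|B|) -sumr_const_nat.
    by rewrite big_nat [RHS]big_nat; apply: eq_bigr => j /andP[_ ->].
  by apply: ler_sum => x _; apply: le_trans (domf_tr x C) _; rewrite Ceq.
have ltCp : (#|C| < p)%N by rewrite ltn_neqAle Cneq.
have [B1|B1] := leqP #|B| 1.
  have {}B1 : #|B| == 1%N by rewrite eqn_leq B1.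
  have [x ->] := cards1P B1.
  rewrite big_set1 cards1 /pollard_bound.
  rewrite (minn_idPl _) ?(leq_trans B0) // big_nat1 add1n /= subn0.
  by rewrite subn_gt0 ltnS leqNgt ltCp.
have /finset.set0Pn[x xB] : B != finset.set0 by rewrite -card_gt0.
have /finset.set0Pn[x' /finset.setD1P[x'x x'B]] : B :\ x != finset.set0.
  by rewrite -card_gt0; move: B1; rewrite (cardsD1 x) xB; lia.
pose tr e : {set 'F_p} := [set e + y | y in C].
(* Otherwise every translate of C meeting B contains B. For y in C, the translate by x - y contains
   x, hence x', so y + (x' - x) is in C: then C is stable under x' - x and is all of Z/pZ. *)
have [e iB0 iB] : 
    exists2 e, (0 < #|B :&: tr e|)%N & (#|B :&: tr e| < #|B|)%N.
  suff /existsP[e /andP[? ?]] :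
    [exists e, (0 < #|B :&: tr e|)%N && (#|B :&: tr e| < #|B|)%N] by exists e.
  apply: contraT => /existsPn noe.
  suff CT : C = finset.setT by move: ltCp; rewrite CT cardsT card_Fp // ltnn.
  apply: (@addr_stable_setT _ _ (x' - x)) => //.
  - by rewrite subr_eq0.
  - by rewrite -card_gt0 (leq_trans B0).
  move=> y yC; have := noe (x - y); rewrite negb_and -leqNgt.
  have xI : x \in B :&: tr (x - y).
    by rewrite inE xB; apply/imsetP; exists y; rewrite ?subrK.
  rewrite leqn0 cards_eq0 (_ : _ == finset.set0 = false) /=; last first.
    by apply: contraTF xI => /eqP->; rewrite inE.
  rewrite -leqNgt => BI.
  have /eqP eqB : B :&: tr (x - y) == B by rewrite eqEcard finset.subsetIl.
  move: x'B; rewrite -eqB inE => /andP[_ /imsetP[c cC ->]].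
  by rewrite (_ : _ - x + y = c) //; ring.
pose C' := tr e; have cardC' : #|C'| = #|C| by rewrite card_imset //; apply: addrI.
pose f' y := f (- e + y).
have domf' (D : {set 'F_p}) : \sum_(x in D) f' x <= G #|D| by apply: domf_tr.
have -> : \sum_(x in B) \sum_(y in C) f (x + y) =
          \sum_(x in B) \sum_(y in C') f' (x + y).
  apply: eq_bigr => x0 _; rewrite big_imset => [|y z _ _]; last exact: addrI.
  by apply: eq_bigr => y _; rewrite /f' [x0 + (e + y)]addrCA addKr.
have cardD : #|B :\: C'| = (#|B| - #|B :&: C'|)%N by rewrite cardsD.
have cardD' : #|C' :\: B| = (#|C| - #|B :&: C'|)%N.
  by rewrite cardsD cardC' finset.setIC.
have cardU : #|B :|: C'| = (#|B| + #|C| - #|B :&: C'|)%N by rewrite cardsU cardC'.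
rewrite sum_setI_setU (@pollard_bound_split _ p G #|B| #|C| #|B :&: C'|).
- rewrite -cardD -cardD' -cardU; apply: lerD; apply: IH => //.
    by rewrite (leq_ltn_trans (geq_minl _ _)) // (leq_trans iB).
  rewrite (leq_ltn_trans (geq_minl _ _)) // cardD.
  by move: iB0 iB ltn; rewrite -/C'; lia.
- by rewrite (ltnW iB).
by rewrite -cardU -[p in leqRHS]card_Fp // max_card.
Qed.

(** * Sums over runs of consecutive residues *)

Definition run_sum (F : nzRingType) (R : nmodType) (g : F -> R) (w : F) (n : nat) : R :=
  \sum_(0 <= k < n) g (w + k%:R).

Definition run_sum2 (F : nzRingType) (R : nmodType) (g : F -> R) (w : F)
    (b c : nat) : R :=
  \sum_(0 <= i < b) run_sum g (w + i%:R) c.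

(** For even k the extra point is on the positive side, as in [order_plus]. *)
Definition run_start (F : nzRingType) (k : nat) : F := - (k.-1./2)%:R.

Definition centered_sum (F : nzRingType) (R : nmodType) (g : F -> R) (n : nat) : R :=
  run_sum g (run_start F n) n.

Section RunSums.
Context (F : nzRingType) (R : zmodType) (g : F -> R).

Lemma run_sumD w m n :
  run_sum g w (m + n) = run_sum g w m + run_sum g (w + m%:R) n.
Proof.
rewrite /run_sum (big_cat_nat (n := m)) ?leq_addr //=; congr (_ + _).
rewrite -{1}[m]add0n big_addn addKn; apply: eq_bigr => k _.
by rewrite natrD -addrA [m%:R + _]addrC.
Qed.

Lemma run_sum2Dl w b b' c :
  run_sum2 g w (b + b') c = run_sum2 g w b c + run_sum2 g (w + b%:R) b' c.
Proof.
rewrite /run_sum2 (big_cat_nat (n := b)) ?leq_addr //=; congr (_ + _).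
rewrite -{1}[b]add0n big_addn addKn; apply: eq_bigr => k _.
by rewrite natrD -addrA [b%:R + _]addrC.
Qed.

Lemma run_sum2C w b c : run_sum2 g w b c = run_sum2 g w c b.
Proof.
rewrite /run_sum2 /run_sum exchange_big /=; apply: eq_bigr => i _.
by apply: eq_bigr => j _; rewrite addrAC.
Qed.

Lemma run_sum2Dr w b c c' :
  run_sum2 g w b (c + c') = run_sum2 g w b c + run_sum2 g (w + c%:R) b c'.
Proof. by rewrite run_sum2C run_sum2Dl !(run_sum2C _ b). Qed.

Lemma run_sum2_1l w c : run_sum2 g w 1 c = run_sum g w c.
Proof. by rewrite /run_sum2 big_nat1 addr0. Qed.

(* The first row and the last column of a rectangle form a single run. *)
Lemma run_sum2_hook w b c :
  run_sum2 g w b.+1 c.+1 = run_sum g w (b + c).+1 + run_sum2 g (w + 1) b c.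
Proof.
rewrite -add1n run_sum2Dl run_sum2_1l -addnS addnC run_sumD -addrA; congr (_ + _).
rewrite -[in LHS](addn1 c) run_sum2Dr addrC; congr (_ + _).
by rewrite run_sum2C run_sum2_1l -addrA nat1r.
Qed.

(** Hooks are peeled off one by one; each starts one step later and is two shorter than the previous
    one. *)
Lemma run_sum2_nested w b c :
  run_sum2 g w b c =
  \sum_(0 <= j < minn b c) run_sum g (w + j%:R) ((b + c).-1 - j.*2).
Proof.
elim: b c w => [|b IH] [|c] w.
- by rewrite /run_sum2 !big_geq.
- by rewrite /run_sum2 !big_geq.
- by rewrite run_sum2C /run_sum2 !big_geq.
rewrite run_sum2_hook minnSS big_nat_recl //= addr0 subn0 addnS; congr (_ + _).
rewrite IH; apply: eq_bigr => j _; rewrite -addrA nat1r; congr run_sum.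
by lia.
Qed.

End RunSums.

Section CenteredSums.
Context (p : nat) (p_pr : prime p) (R : zmodType) (g : 'F_p -> R).

Lemma run_sum_period w : run_sum g w p = \sum_x g x.
Proof.
have pE : p = (Zp_trunc (pdiv p)).+2 by rewrite (Fp_cast p_pr).
rewrite /run_sum [X in index_iota _ X]pE big_mkord.
rewrite [RHS](reindex (fun i : 'F_p => w + i)) /=; last first.
  by exists (fun i => - w + i) => i _; rewrite ?addKr // addNKr.
by apply: eq_bigr => i _; rewrite natr_Zp.
Qed.

Lemma centered_sum_period : centered_sum g p = \sum_x g x.
Proof. exact: run_sum_period. Qed.

(** With q = b + c - p, the first q columns of the first b - q rows, transposed, continue with the
    last q rows into q rows of length p, each a full period. A block of b - q rows and c - q columns
    remains. *)
Lemma run_sum2_wrap w b c : (b <= p)%N -> (c <= p)%N ->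
  run_sum2 g w b c = (\sum_x g x) *+ (b + c - p) +
    run_sum2 g (w + (b + c - p)%:R) (b - (b + c - p)) (c - (b + c - p)).
Proof.
move=> bp cp; set q := (b + c - p)%N.
have [q0|q_gt0] := posnP q; first by rewrite q0 mulr0n add0r addr0 !subn0.
have eb : b = (b - q + q)%N by rewrite subnK //; rewrite /q; lia.
have ec : c = (q + (c - q))%N by rewrite subnKC //; rewrite /q; lia.
have per u : run_sum2 g u q p = (\sum_x g x) *+ q.
  rewrite /run_sum2; under eq_bigr do rewrite run_sum_period.
  by rewrite sumr_const_nat subn0.
rewrite {1}eb run_sum2Dl {1}ec run_sum2Dr -addrA [X in _ + X]addrC addrA.
rewrite [X in X + _ + _]run_sum2C -run_sum2Dr.
by rewrite (_ : (b - q + c)%N = p) ?per //; rewrite /q; lia.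
Qed.

(** With b odd, halving b - 1 loses nothing, so every nested run is again centered. Two even runs
    would give runs that are off by one. *)
Lemma run_sum2_centered b c : odd b -> (b <= p)%N -> (c <= p)%N ->
  run_sum2 g (run_start _ b + run_start _ c) b c =
  pollard_bound p (centered_sum g) b c.
Proof.
move=> odd_b bp cp; rewrite run_sum2_wrap // run_sum2_nested /pollard_bound.
set q := (b + c - p)%N.
have qm : (q <= minn b c)%N by rewrite /q; lia.
rewrite [RHS](big_cat_nat (n := q)) //=; congr (_ + _).
  rewrite -[in LHS](subn0 q) -sumr_const_nat.
  by apply: eq_big_nat => j /andP[_ ->]; rewrite centered_sum_period.
rewrite [RHS](big_addn 0 _ q) -subn_minl.
apply: eq_big_nat => j /andP[_ jq]; rewrite ltnNge leq_addl /=.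
have -> : ((b - q + (c - q)).-1 - j.*2 = (b + c).-1 - (j + q).*2)%N by lia.
rewrite /centered_sum; congr run_sum; rewrite /run_start.
set N := ((b + c).-1 - (j + q).*2)%N.
have eN : (b.-1./2 + c.-1./2 = N.-1./2 + (q + j))%N by rewrite /N; lia.
by rewrite -opprD -natrD eN !natrD opprD; ring.
Qed.

End CenteredSums.

(** * Domination under convolution with a triangle *)

Section LayeredConvolution.
Context (p : nat) (p_pr : prime p) (R : numDomainType).
Implicit Types (f g t : 'F_p -> R) (lam : nat -> R) (a : 'F_p).

Definition dominated f g : Prop :=
  forall C : {set 'F_p}, \sum_(x in C) f x <= centered_sum g #|C|.

(** The inner sum is the indicator of [-r, r] when 2r + 1 <= p, written with point masses so that
    convolving with it gives a sum of translates. *)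
Definition layered lam (y : 'F_p) : R :=
  \sum_(0 <= r < p./2.+1)
    lam r * \sum_(0 <= i < r.*2.+1) (y == i%:R - r%:R)%:R.

(** The law of a Y + Z, for independent Y of law [t] and Z of law [f]. *)
Definition dilated_conv a t f (z : 'F_p) : R := \sum_y t y * f (z - y * a).

Lemma dilated_conv_layered a lam f z :
  dilated_conv a (layered lam) f z =
  \sum_(0 <= r < p./2.+1)
    lam r * \sum_(0 <= i < r.*2.+1) f (z - (i%:R - r%:R) * a).
Proof.
rewrite /dilated_conv /layered.
under eq_bigr do rewrite mulr_suml.
rewrite exchange_big /=; apply: eq_bigr => r _.
under eq_bigr do rewrite -mulrA mulr_suml.
rewrite -mulr_sumr exchange_big /=; congr (_ * _); apply: eq_bigr => i _.
rewrite (bigD1 (i%:R - r%:R)) //= eqxx mul1r big1 ?addr0 // => y /negPf->.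
by rewrite mul0r.
Qed.

Lemma natr_Fp_inj (i j : nat) : (i < p)%N -> (j < p)%N ->
  i%:R = j%:R :> 'F_p -> i = j.
Proof.
move=> ip jp /(congr1 (@nat_of_ord _)); rewrite !val_Fp_nat //.
by rewrite !modn_small.
Qed.

(** It suffices to treat one layer [-r, r]. Dilation by a changes this set but not its cardinality,
    so Pollard's inequality gives the same bound for every a; the undilated layer and a centered run
    attain it, as 2r + 1 is odd. *)
Lemma dominated_dilated_conv a lam f g : (2 < p)%N -> a != 0 ->
  (forall r, 0 <= lam r) -> dominated f g ->
  dominated (dilated_conv a (layered lam) f) (dilated_conv 1 (layered lam) g).
Proof.
move=> p_gt2 a0 lam0 fg C.
have odd_p : odd p by case: (even_prime p_pr) p_gt2 => [->|].
under eq_bigr do rewrite dilated_conv_layered.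
rewrite /centered_sum /run_sum.
under [leRHS]eq_bigr do rewrite dilated_conv_layered.
rewrite exchange_big [leRHS]exchange_big /=.
rewrite big_nat_cond [leRHS]big_nat_cond; apply: ler_sum => r /andP[/andP[_ rp] _].
rewrite -!mulr_sumr ler_wpM2l //.
have bp : (r.*2.+1 <= p)%N by lia.
have cp : (#|C| <= p)%N by rewrite -[p in leqRHS]card_Fp // max_card.
pose B := [set - ((nat_of_ord i)%:R - r%:R) * a | i : 'I_(r.*2.+1)].
have Binj : injective (fun i : 'I_(r.*2.+1) => - ((nat_of_ord i)%:R - r%:R) * a).
  move=> i j /(mulIf a0) /oppr_inj /addIr ij; apply/val_inj/natr_Fp_inj => //.
    exact: leq_trans (ltn_ord i) bp.
  exact: leq_trans (ltn_ord j) bp.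
have cardB : #|B| = r.*2.+1 by rewrite card_imset // card_ord.
have := sum_set_pollard B C p_pr fg; rewrite cardB -run_sum2_centered //; last first.
  by rewrite /= odd_double.
congr (_ <= _).
  rewrite exchange_big /=; apply: eq_bigr => z _.
  rewrite big_imset /= => [|i j _ _]; last exact: Binj.
  by rewrite big_mkord; apply: eq_bigr => i _; rewrite mulNr addrC.
rewrite /run_sum2 /run_sum exchange_big; apply: eq_bigr => k _.
(* The layer is symmetric: reversing i turns the differences into an increasing run. *)
rewrite [RHS]big_nat_rev; apply: eq_big_nat => i /andP[_ ir].
congr g; rewrite add0n mulr1 /run_start /= doubleK subSS natrB //.
rewrite -addnn natrD; ring.
Qed.

End LayeredConvolution.

(** * Symmetric unimodal functions as sums of layers *)

Section FpHalves.
Context (p : nat) (p_pr : prime p) (p_gt2 : (2 < p)%N).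

Lemma odd_prime_gt2 : odd p.
Proof. by case: (even_prime p_pr) p_gt2 => [->|]. Qed.

Lemma natr_Fp_eq0 : p%:R = 0 :> 'F_p.
Proof. exact: pchar_Fp_0. Qed.

Lemma natr_Fp_half (h j : nat) : (h + j = p)%N -> h%:R = - j%:R :> 'F_p.
Proof.
by move=> hj; apply/eqP; rewrite -addr_eq0 -natrD hj natr_Fp_eq0.
Qed.

Lemma Fp_halfP (z : 'F_p) :
  exists2 j, (j <= p./2)%N & z = j%:R \/ z = - j%:R.
Proof.
have zp : (z < p)%N by rewrite -[X in (_ < X)%N](Fp_cast p_pr) ltn_ord.
have odd_p := odd_prime_gt2.
have [zh|zh] := leqP z p./2.
  by exists (z : nat) => //; left; rewrite natr_Zp.
exists (p - z)%N; first by lia.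
right; rewrite -(@natr_Fp_half z) ?natr_Zp //; lia.
Qed.

End FpHalves.

Section LayeredProfile.
Context (p : nat) (p_pr : prime p) (p_gt2 : (2 < p)%N) (R : numDomainType).

Lemma sum_layer (z : 'F_p) (j r : nat) : z = j%:R \/ z = - j%:R ->
  (j <= p./2)%N -> (r <= p./2)%N ->
  \sum_(0 <= i < r.*2.+1) (z == i%:R - r%:R)%:R = (j <= r)%:R :> R.
Proof.
move=> zj jm rm; have odd_p := odd_prime_gt2 p_pr p_gt2.
have [jr|jr] := leqP j r.
  have [k kr zk] : exists2 k, (k < r.*2.+1)%N & z = k%:R - r%:R.
    case: zj => ->.
      by exists (r + j)%N; [lia | rewrite natrD addrAC subrr add0r].
    exists (r - j)%N; first by lia.
    by rewrite natrB // addrAC subrr add0r.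
  rewrite big_mkord (bigD1 (Ordinal kr)) //= zk eqxx big1 ?addr0 // => i ik.
  case: eqP => // /addIr /(natr_Fp_inj p_pr) ki; move: ik; rewrite -val_eqE /=.
  by rewrite ki ?eqxx //; have := ltn_ord i; lia.
rewrite big_nat big1 // => i /= ir; case: eqP => // zi.
have {zi} : z + r%:R = i%:R by rewrite zi subrK.
case: zj => ->; first by rewrite -natrD => /(natr_Fp_inj p_pr); lia.
rewrite -(@natr_Fp_half _ p_pr (p - j)); last by lia.
by rewrite -natrD => /(natr_Fp_inj p_pr); lia.
Qed.

(** Layer-cake decomposition: [-r, r] is weighted by the drop of f from distance r to r + 1, and the
    weights with r >= j telescope to [q j - q p./2]. *)
Lemma symmetric_layered (f : 'F_p -> R) (h : 'F_p) (q : nat -> R) :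
  (forall j, (j <= p./2)%N -> f (h + j%:R) = q j /\ f (h - j%:R) = q j) ->
  (forall j, (j < p./2)%N -> q j.+1 <= q j) ->
  exists2 lam : nat -> R, forall r, 0 <= lam r &
    forall y, f y = q p./2 + layered lam (y - h).
Proof.
move=> fq qdecr.
exists (fun r => if (r < p./2)%N then q r - q r.+1 else 0).
  by move=> r; case: ifP => // /qdecr; rewrite subr_ge0.
move=> y; have [j jm yj] := Fp_halfP p_pr p_gt2 (y - h).
have -> : f y = q j.
  have [fp fm] := fq _ jm.
  by rewrite -[y](subrK h) addrC; case: yj => ->.
rewrite /layered.
under eq_big_nat => r /andP[_ rm] do rewrite (sum_layer yj) //.
rewrite (big_cat_nat (n := j)) //=; last exact: leqW.
rewrite big_nat big1 ?add0r => [|r /= rj]; last first.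
  by rewrite (_ : (j <= r)%N = false) ?mulr0 //; lia.
rewrite big_nat_recr //= ltnn mul0r addr0.
under eq_big_nat => r /andP[jr rm] do rewrite jr mulr1 rm.
rewrite (@telescope_sumr_eq _ _ _ (fun r => - q r)) // => [|r _].
  by rewrite opprK addrA subrr add0r.
by rewrite opprK addrC.
Qed.

End LayeredProfile.

(** * The shape of regular functions *)

Section RegularProfiles.
Context (R : realType) (p : nat) (p_pr : prime p) (p_gt2 : (2 < p)%N).
Implicit Types f : 'F_p -> R.

(** Common form of [order_plus] and [order_minus], so that positions are computed only once. *)
Definition alternating_order (u v : nat -> 'F_p) : seq 'F_p :=
  0 :: flatten [seq [:: u j; v j] | j <- iota 1 p.-1./2].

Lemma nth_flatten_pairs (T : Type) (x0 : T) (u v : nat -> T) s n i : (i < n)%N ->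
  nth x0 (flatten [seq [:: u j; v j] | j <- iota s n]) i.*2 = u (s + i)%N /\
  nth x0 (flatten [seq [:: u j; v j] | j <- iota s n]) i.*2.+1 = v (s + i)%N.
Proof.
elim: n s i => // n IH s [|i] /=; first by rewrite addn0.
by rewrite ltnS => /(IH s.+1); rewrite addSnnS.
Qed.

Lemma size_flatten_pairs (T : Type) (u v : nat -> T) s n :
  size (flatten [seq [:: u j; v j] | j <- iota s n]) = n.*2.
Proof. by elim: n s => //= n IH s; rewrite IH. Qed.

Section AlternatingOrder.
Context (u v : nat -> 'F_p).
Context (uv : forall j, u j = j%:R /\ v j = - j%:R \/ u j = - j%:R /\ v j = j%:R).

Lemma half_predn : p.-1./2 = p./2.
Proof. by have := odd_prime_gt2 p_pr p_gt2; lia. Qed.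

Lemma alternating_order_nth j : (0 < j <= p./2)%N ->
  nth 0 (alternating_order u v) j.*2.-1 = u j /\
  nth 0 (alternating_order u v) j.*2 = v j.
Proof.
case: j => // j jm; rewrite doubleS /=.
by apply: (nth_flatten_pairs 0 u v 1); rewrite half_predn; lia.
Qed.

Lemma size_alternating_order : size (alternating_order u v) = p.
Proof.
rewrite /= size_flatten_pairs half_predn.
by have := odd_prime_gt2 p_pr p_gt2; lia.
Qed.

Lemma alternating_order_uniq : uniq (alternating_order u v).
Proof.
apply: (@leq_size_uniq _ (enum 'F_p)); first exact: enum_uniq.
  move=> z _; have [[|j] jm zj] := Fp_halfP p_pr p_gt2 z.
    by case: zj => ->; rewrite ?oppr0 in_cons eqxx.
  have [nu nv] : _ := @alternating_order_nth j.+1 jm.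
  have odd_p := odd_prime_gt2 p_pr p_gt2.
  have u_in : u j.+1 \in alternating_order u v.
    by rewrite -nu mem_nth // size_alternating_order; lia.
  have v_in : v j.+1 \in alternating_order u v.
    by rewrite -nv mem_nth // size_alternating_order; lia.
  by case: (uv j.+1) zj => -[<- <-] [] ->.
by rewrite size_alternating_order -cardE card_Fp.
Qed.

Lemma index_alternating_order j : (0 < j <= p./2)%N ->
  index (u j) (alternating_order u v) = j.*2.-1 /\
  index (v j) (alternating_order u v) = j.*2.
Proof.
move=> jm; have [nu nv] := alternating_order_nth jm.
have odd_p := odd_prime_gt2 p_pr p_gt2.
by split; [rewrite -nu | rewrite -nv]; rewrite index_uniq ?alternating_order_uniq //
  size_alternating_order; lia.
Qed.

End AlternatingOrder.

Lemma rearr_plusE f j : (0 < j <= p./2)%N ->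
  rearr_plus f j%:R = nth 0 (values_decr f) j.*2.-1 /\
  rearr_plus f (- j%:R) = nth 0 (values_decr f) j.*2.
Proof.
move=> jm; rewrite /rearr_plus.
have [|-> ->//] := @index_alternating_order (fun j => j%:R) (fun j => - j%:R) _ j jm.
by left.
Qed.

Lemma rearr_minusE f j : (0 < j <= p./2)%N ->
  rearr_minus f j%:R = nth 0 (values_decr f) j.*2 /\
  rearr_minus f (- j%:R) = nth 0 (values_decr f) j.*2.-1.
Proof.
move=> jm; rewrite /rearr_minus.
have [|-> ->//] := @index_alternating_order (fun j => - j%:R) (fun j => j%:R) _ j jm.
by right.
Qed.

Lemma rearr_plus0 f : rearr_plus f 0 = nth 0 (values_decr f) 0.
Proof. by []. Qed.

Lemma rearr_minus0 f : rearr_minus f 0 = nth 0 (values_decr f) 0.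
Proof. by []. Qed.

Lemma values_decr_le f i j : (i <= j < p)%N ->
  nth 0 (values_decr f) j <= nth 0 (values_decr f) i.
Proof.
move=> /andP[ij jp].
have sz : size (values_decr f) = p.
  by rewrite size_sort size_map -cardE card_Fp.
have geT : transitive (>=%O : rel R) by move=> x y z /[swap]; exact: le_trans.
have := sorted_leq_nth geT (fun x => lexx x) 0 (sort_sorted _ [seq f z | z : 'F_p]).
move=> /(_ (fun x y => le_total y x) i j); apply => //; rewrite inE sz //.
exact: leq_ltn_trans jp.
Qed.

(* Up to sign and an additive constant, a square-regular function is a
   triangle: its level sets are even intervals, so the complementary intervals
   are odd, centered at the point opposite to the half-integer center. *)
Definition signed_triangle f : Prop :=
  exists (k : R) (s : bool) (h : 'F_p) (lam : nat -> R),
    (forall r, 0 <= lam r) /\ forall y, f y = k + (-1) ^+ s * layered lam (y - h).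

(** Ranks 2j - 1 and 2j sit at j and -j in f^+, and at -j and j in f^-. Equality of the two makes f
    symmetric about 0. *)
Lemma triangle_regular_signed f : triangle_regular f ->
  f =1 rearr_plus f -> signed_triangle f.
Proof.
move=> ftri fE; have odd_p := odd_prime_gt2 p_pr p_gt2.
have [|j jm|lam lam0 flam] := @symmetric_layered p p_pr p_gt2 R f 0
    (fun j => nth 0 (values_decr f) j.*2).
- move=> [|j] jm; first by rewrite oppr0 addr0 fE rearr_plus0.
  rewrite !add0r; split; rewrite fE.
    by rewrite ftri; have [] := rearr_minusE f (jm : (0 < j.+1 <= p./2)%N).
  by have [] := rearr_plusE f (jm : (0 < j.+1 <= p./2)%N).
- by apply: values_decr_le; lia.
by exists (nth 0 (values_decr f) p./2.*2), false, 0, lam; split=> // y;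
  rewrite expr0 mul1r.
Qed.

(** The relation at z = j equates the values of ranks 2j and 2j + 1, so only the least value is left
    unpaired. Around the point carrying it f is symmetric and increasing with the distance, so -f is
    a triangle centered there. *)
Lemma square_regular_signed f : square_regular f ->
  f =1 rearr_plus f \/ f =1 rearr_minus f -> signed_triangle f.
Proof.
have odd_p := odd_prime_gt2 p_pr p_gt2.
case=> [f0 _|[_ fsq] fE].
  exists 0, false, 0, (fun=> 0); split=> // y.
  by rewrite f0 /layered big1 ?mulr0 ?addr0 // => r _; rewrite mul0r.
pose v := nth 0 (values_decr f).
have vpair j : (j < p./2)%N -> v j.*2.+1 = v j.*2.
  move=> jm; have := fsq j%:R; rewrite natr1.
  have [-> _] := rearr_plusE f (jm : (0 < j.+1 <= p./2)%N).
  case: j jm => [|j] jm; first by rewrite rearr_minus0.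
  by have [-> _] := rearr_minusE f (ltnW jm : (0 < j.+1 <= p./2)%N).
have plusE j : (j <= p./2)%N -> rearr_plus f (- j%:R) = v j.*2.
  case: j => [|j] jm; rewrite ?oppr0 ?rearr_plus0 //.
  by have [] := rearr_plusE f (jm : (0 < j.+1 <= p./2)%N).
have minusE j : (j <= p./2)%N -> rearr_minus f j%:R = v j.*2.
  case: j => [|j] jm; rewrite ?rearr_minus0 //.
  by have [] := rearr_minusE f (jm : (0 < j.+1 <= p./2)%N).
(* Since p is twice [p./2] plus 1, a point beyond the last positive representative reappears among
   the negative ones. *)
have wrap j : (0 < j <= p./2)%N ->
    (p./2 - j).+1%:R = - (p./2%:R + j%:R) :> 'F_p.
  by move=> jm; rewrite -natrD; apply: (natr_Fp_half p_pr); lia.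
(* The center is the last point of the order in use, [- p./2%:R] for f^+ and [p./2%:R] for f^-. *)
have [h fh] : exists h, forall j, (j <= p./2)%N ->
    f (h + j%:R) = v (p./2 - j).*2 /\ f (h - j%:R) = v (p./2 - j).*2.
  case: fE => fE.
    exists (- p./2%:R) => j jm; rewrite !fE; split.
      by rewrite -plusE ?leq_subr // natrB // opprB addrC.
    case: j jm => [|j] jm; first by rewrite subr0 subn0 plusE.
    rewrite -opprD -wrap // -vpair; last by lia.
    by have [|-> _] := @rearr_plusE f (p./2 - j.+1).+1; first by lia.
  exists (p./2%:R) => j jm; rewrite !fE; split; last first.
    by rewrite -minusE ?leq_subr // natrB.
  case: j jm => [|j] jm; first by rewrite addr0 subn0 minusE.
  rewrite -[_ + _]opprK -wrap // -vpair; last by lia.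
  by have [|_ ->] := @rearr_minusE f (p./2 - j.+1).+1; first by lia.
have [|j jm|lam lam0 flam] := @symmetric_layered p p_pr p_gt2 R (fun y => - f y) h
    (fun j => - v (p./2 - j).*2).
- by move=> j /fh[-> ->].
- by rewrite lerN2; apply: values_decr_le; lia.
exists (v (p./2 - p./2).*2), true, h, lam; split=> // y.
by rewrite expr1 mulN1r -[LHS]opprK flam opprD opprK.
Qed.

End RegularProfiles.

(** * Majorization of the convolutions *)

(** Equivalent to comparing the sums of the k largest values for every k, but free of sorting. *)
Definition majorized (R : numDomainType) (I : finType) (u v : I -> R) : Prop :=
  \sum_x u x = \sum_x v x /\
  forall C : {set I}, exists2 D : {set I},
    #|D| = #|C| & \sum_(x in C) u x <= \sum_(x in D) v x.

Section ConvolutionDomination.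
Context (R : realType) (p : nat) (p_pr : prime p) (p_gt2 : (2 < p)%N).
Implicit Types f g : 'F_p -> R.

(** The invariant of the induction on the factors: s is the parity of the number of negated
    triangles, h accumulates their translations, and equal totals make the additive constants
    contribute equally. *)
Definition signed_dominated f g : Prop :=
  \sum_x f x = \sum_x g x /\
  exists (s : bool) (h : 'F_p),
    dominated (fun x => (-1) ^+ s * f x) (fun x => (-1) ^+ s * g (x + h)).

Lemma sum_dilated_conv (a : 'F_p) t f :
  \sum_z dilated_conv a t f z = (\sum_y t y) * \sum_z f z.
Proof.
rewrite /dilated_conv exchange_big mulr_suml; apply: eq_bigr => y _ /=.
rewrite -mulr_sumr; congr (_ * _).
rewrite [RHS](reindex (fun z => z - y * a)) //=.
by exists (fun z => z + y * a) => z _; rewrite ?subrK ?addrK.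
Qed.

Lemma dilated_conv_shift (a : 'F_p) (k c : R) (h : 'F_p) t f z : a != 0 ->
  dilated_conv a (fun y => k + c * t (y - h)) f z =
  k * (\sum_x f x) + c * dilated_conv a t f (z - h * a).
Proof.
move=> a0.
rewrite /dilated_conv; under eq_bigr do rewrite mulrDl.
rewrite big_split /=; congr (_ + _).
  rewrite -mulr_sumr; congr (_ * _).
  rewrite [RHS](reindex (fun y => z - y * a)) //=.
  exists (fun x => (z - x) / a) => x _; first by rewrite subKr mulfK.
  by rewrite divfK // subKr.
rewrite (reindex (fun y => y + h)) /=; last first.
  by exists (fun y => y - h) => y _; rewrite ?addrK ?subrK.
rewrite mulr_sumr; apply: eq_bigr => y _.
by rewrite addrK mulrA mulrDl opprD addrA addrAC.
Qed.

(** The constant k adds the same amount on both sides. The translation by [h0 * a] on the left is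
    absorbed by moving the set D, the one by h0 on the right is added to h. *)
Lemma signed_dominated_dilated_conv (a : 'F_p) t f g :
  a != 0 -> signed_triangle t -> signed_dominated f g ->
  signed_dominated (dilated_conv a t f) (dilated_conv 1 t g).
Proof.
move=> a0 [k [s0 [h0 [lam [lam0 tE]]]]] [fg [s [h dom]]].
split; first by rewrite !sum_dilated_conv fg.
exists (s (+) s0), (h + h0) => D.
have dcE b f' : b != 0 -> dilated_conv b t f' =1 fun z =>
    k * (\sum_x f' x) + (-1) ^+ s0 * dilated_conv b (layered lam) f' (z - h0 * b).
  by move=> b0 z; rewrite -dilated_conv_shift //; apply: eq_bigr => y _; rewrite tE.
have dcZ b c f' z : dilated_conv b (layered lam) (fun x => c * f' x) z =
    c * dilated_conv b (layered lam) f' z.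
  by rewrite mulr_sumr; apply: eq_bigr => y _; rewrite mulrCA.
set k' := (-1) ^+ (s (+) s0) * (k * \sum_x f x).
have -> : (fun x => (-1) ^+ (s (+) s0) * dilated_conv 1 t g (x + (h + h0))) =
    fun x => k' + dilated_conv 1 (layered lam) (fun x => (-1) ^+ s * g (x + h)) x.
  apply/funext => x; rewrite dcE ?oner_eq0 // mulrDr -fg -/k' mulr1; congr (_ + _).
  rewrite dcZ mulrA -signr_addb addbK; congr (_ * _).
  by apply: eq_bigr => y _; congr (_ * g _); ring.
under eq_bigr do rewrite (dcE a) // mulrDr -/k' mulrA -signr_addb addbK -dcZ.
have -> (g' : 'F_p -> R) n :
    centered_sum (fun x => k' + g' x) n = k' *+ n + centered_sum g' n.
  by rewrite /centered_sum /run_sum big_split /= sumr_const_nat subn0.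
rewrite big_split /= sumr_const lerD2l.
under eq_bigr do rewrite addrC.
rewrite (sum_translate (dilated_conv a _ _)).
set D' := imset _ _; have -> : #|D| = #|D'| by rewrite card_imset //; apply: addrI.
exact: dominated_dilated_conv.
Qed.

Lemma signed_dominated_delta :
  signed_dominated (fun z => (z == 0)%:R) (fun z => (z == 0)%:R).
Proof.
split=> //; exists false, 0 => D.
have [->|/set0Pn[x xD]] := eqVneq D finset.set0.
  by rewrite big_set0 cards0 /centered_sum /run_sum big_geq.
have D0 : (0 < #|D|)%N by apply/card_gt0P; exists x.
apply: (@le_trans _ _ 1).
  rewrite -[leRHS](_ : \sum_x (x == 0 :> 'F_p)%:R = 1); last first.
    by rewrite (bigD1 0) //= big1 ?addr0 // => y /negPf->.
  rewrite expr0; under eq_bigr do rewrite mul1r.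
  by rewrite [leRHS](bigID (mem D)) /= lerDl sumr_ge0.
(* The index at which the centered run passes through 0. *)
have kD : (#|D|.-1./2 < #|D|)%N by lia.
rewrite /centered_sum /run_sum big_mkord (bigD1 (Ordinal kD)) //=.
rewrite /run_start addNr addr0 eqxx expr0 mul1r lerDl.
by apply: sumr_ge0 => i _; rewrite mul1r.
Qed.

(** If the sign is negative, domination is applied to the complement of C: a lower bound there is an
    upper bound on C, as the totals agree. *)
Lemma signed_dominated_majorized f g : signed_dominated f g -> majorized f g.
Proof.
move=> [fg [s [h dom]]]; split=> // C.
have runE (g' : 'F_p -> R) (D : {set 'F_p}) : exists2 D' : {set 'F_p},
    #|D'| = #|D| & centered_sum (fun x => g' (x + h)) #|D| = \sum_(x in D') g' x.
  have Dp : (#|D| <= p)%N by rewrite -[p in leqRHS]card_Fp // max_card.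
  pose e (k : 'I_#|D|) : 'F_p := run_start _ #|D| + (k : nat)%:R + h.
  have e_inj : injective e.
    move=> i j /addIr/addrI ij; apply/val_inj/(natr_Fp_inj p_pr) => //.
      exact: leq_trans (ltn_ord i) Dp.
    exact: leq_trans (ltn_ord j) Dp.
  exists [set e k | k : 'I_#|D|]; first by rewrite card_imset // card_ord.
  rewrite big_imset /= => [|i j _ _]; last exact: e_inj.
  by rewrite /centered_sum /run_sum big_mkord.
case: s dom => dom.
  have [D cD DE] := runE (fun x => - g x) (~: C).
  exists (~: D).
    by apply/eqP; rewrite -(eqn_add2l #|D|) cardsC cD addnC cardsC.
  have := dom (~: C).
  under eq_bigr do rewrite expr1 mulN1r.
  rewrite (_ : (fun x => _ * g _) = fun x => - g (x + h)); last first.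
    by apply/funext => x; rewrite expr1 mulN1r.
  rewrite DE !sumrN lerN2.
  have := fg; rewrite (bigID (mem C)) [RHS](bigID (mem D)) /=.
  have setCE (A : {set 'F_p}) (F : 'F_p -> R) :
      \sum_(x in ~: A) F x = \sum_(x | x \notin A) F x.
    by apply: eq_bigl => x; rewrite inE.
  rewrite !setCE; set a := \sum_(x in C) _; set b := \sum_(x | _) f x.
  by set c := \sum_(x in D) _; set d := \sum_(x | _) _; lra.
have [D cD DE] := runE g C; exists D => //; rewrite -DE.
have := dom C; under eq_bigr do rewrite expr0 mul1r.
rewrite (_ : (fun x => _ * g _) = fun x => g (x + h)) //.
by apply/funext => x; rewrite expr0 mul1r.
Qed.

End ConvolutionDomination.


(* Support lines are only required at interior points, so that phi may have an
   infinite slope at 0. *)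
Definition has_support_lines (R : numDomainType) (phi : R -> R) : Prop :=
  forall y, 0 < y -> exists c, forall x, 0 <= x -> phi y + c * (x - y) <= phi x.

(** * Karamata's inequality *)

Section Karamata.
Context (R : realFieldType).

(** The points are treated from the largest down. To the left of the last point treated, h is affine
    and below phi, so at the next point a hinge of nonnegative weight lifts h to phi. *)
Lemma hinge_interpolation (K : (R -> R) -> Prop) (phi : R -> R) :
  (forall a b, K (fun x => a + b * x)) ->
  (forall h mu z, K h -> 0 <= mu -> K (fun x => h x + mu * Num.max 0 (z - x))) ->
  has_support_lines phi ->
  forall y s, path <%R y s -> 0 <= y ->
  exists h a b, [/\ K h, {in y :: s, h =1 phi}, forall x, x <= y -> h x = a + b * x
    & forall x, 0 <= x -> x <= y -> a + b * x <= phi x].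
Proof.
move=> Kaff Khinge supp y s; elim: s y => [|z s IH] y /=.
  move=> _; rewrite le_eqVlt => /predU1P[<-|y_gt0].
    exists (fun x => phi 0 + 0 * x), (phi 0), 0; split=> // [x|x x0 x0'].
      by rewrite inE => /eqP->; rewrite mul0r addr0.
    have -> : x = 0 by apply/le_anti; rewrite x0 x0'.
    by rewrite mul0r addr0.
  have [c suppc] := supp y y_gt0.
  exists (fun x => phi y - c * y + c * x), (phi y - c * y), c; split=> // [x|x x0 _].
    by rewrite inE => /eqP->; rewrite subrK.
  by apply: le_trans (suppc x x0); lra.
move=> /andP[yz zs] y0; have z0 : 0 <= z by apply: le_trans (ltW yz).
have [h [a [b [Kh hphi hab abphi]]]] := IH z zs z0.
have zy : 0 < z - y by rewrite subr_gt0.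
pose mu := (phi y - (a + b * y)) / (z - y).
have mu0 : 0 <= mu by rewrite divr_ge0 ?(ltW zy) // subr_ge0 abphi // ltW.
have mu_y : mu * (z - y) = phi y - (a + b * y) by rewrite divfK // gt_eqF.
exists (fun x => h x + mu * Num.max 0 (z - x)), (a + mu * z), (b - mu); split.
- exact: Khinge.
- move=> x; rewrite in_cons => /predU1P[->|xzs].
    by rewrite max_r ?(ltW zy) // mu_y hab ?(ltW yz) // addrC subrK.
  rewrite max_l ?mulr0 ?addr0 ?hphi // subr_le0.
  move: xzs; rewrite in_cons => /predU1P[->//|xs].
  have /allP := order_path_min lt_trans zs.
  by move=> /(_ x xs) /ltW.
- move=> x xy; rewrite hab; last exact: le_trans (ltW yz).
  rewrite max_r; last by rewrite subr_ge0 (le_trans xy) // ltW.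
  by ring.
move=> x x0; rewrite le_eqVlt => /predU1P[->|xy].
  rewrite (_ : _ + _ = a + b * y + mu * (z - y)); last by ring.
  by rewrite mu_y addrC subrK.
have [c suppc] := supp y (le_lt_trans x0 xy).
have phiz : phi z = a + b * z by rewrite -hphi ?mem_head // hab.
have cz := suppc z z0.
(* The support line at y is below phi at z, so its slope is at most that of the chord from y to z;
   left of y the chord is then the lower line. *)
have {}cz : c * (z - y) <= (b - mu) * (z - y).
  rewrite mulrBl mu_y; move: cz; rewrite phiz; lra.
have cb : c <= b - mu by rewrite -(ler_pM2r zy).
apply: le_trans (suppc x x0).
have -> : phi y = a + mu * z + (b - mu) * y.
  by apply/eqP; rewrite -subr_eq0; apply/eqP; move: mu_y; lra.
have := ler_wpM2r (ltW (_ : 0 < y - x)) cb.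
by rewrite subr_gt0 => /(_ xy); lra.
Qed.

Context (I : finType) (u v : I -> R) (uv : majorized u v).

(** The left side is the sum of z - u over the complement of the set where u >= z. Majorization
    bounds it by a sum of z - v over some complement, hence by the sum of positive parts. *)
Lemma majorized_hinge (z : R) :
  \sum_x Num.max 0 (z - u x) <= \sum_x Num.max 0 (z - v x).
Proof.
have [D DC uvD] := uv.2 [set x | z <= u x]%SET.
set C := finset.finset _ in DC uvD.
have sumE (w : I -> R) (A : {set I}) :
    \sum_(x in ~: A) (z - w x) =
    z *+ #|I| - \sum_x w x - (z *+ #|A| - \sum_(x in A) w x).
  have -> : \sum_(x in ~: A) (z - w x) = \sum_(x | x \notin A) (z - w x).
    by apply: eq_bigl => x; rewrite inE.
  rewrite -sumr_const -(sumr_const (mem A)) -!sumrB.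
  by rewrite [X in _ = X - _](bigID (mem A)) /= addrAC subrr add0r.
have -> : \sum_x Num.max 0 (z - u x) = \sum_(x in ~: C) (z - u x).
  rewrite (bigID (mem C)) /= big1 ?add0r => [|x]; last first.
    by rewrite inE => zx; rewrite max_l // subr_le0.
  rewrite [RHS](eq_bigl (fun x => x \notin C)) => [|x]; last by rewrite inE.
  by apply: eq_bigr => x; rewrite inE -ltNge => xz; rewrite max_r // subr_ge0 ltW.
apply: (@le_trans _ _ (\sum_(x in ~: D) (z - v x))).
  by rewrite !sumE DC uv.1; lra.
rewrite [leRHS](bigID (mem (~: D))) /=.
rewrite -[leLHS]addr0 lerD //; last by apply: sumr_ge0 => x _; rewrite le_max lexx.
by apply: ler_sum => x _; rewrite le_max lexx orbT.
Qed.

Lemma majorized_convex (phi : R -> R) : has_support_lines phi ->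
  (forall x, 0 <= u x) -> (forall x, 0 <= v x) ->
  \sum_x phi (u x) <= \sum_x phi (v x).
Proof.
move=> supp u0 v0.
pose K (h : R -> R) := \sum_x h (u x) <= \sum_x h (v x).
have Kaff a b : K (fun x => a + b * x).
  by rewrite /K !big_split /= -!mulr_sumr uv.1.
have Khinge h mu z : K h -> 0 <= mu -> K (fun x => h x + mu * Num.max 0 (z - x)).
  move=> Kh mu0; rewrite /K !big_split /= -!mulr_sumr lerD //.
  by rewrite ler_wpM2l // majorized_hinge.
have [h Kh hphi] : exists2 h, K h &
    {in [seq u i | i : I] ++ [seq v i | i : I], h =1 phi}.
  set s0 := _ ++ _.
  have s0_ge0 x : x \in s0 -> 0 <= x.
    by rewrite mem_cat => /orP[] /mapP[i _ ->].
  have s_lt : sorted <%R (sort <=%R (undup s0)) by rewrite sort_lt_sorted undup_uniq.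
  have s_in : sort <=%R (undup s0) =i s0 by move=> x; rewrite mem_sort mem_undup.
  case: (sort _ _) s_lt s_in => [|y s] /= s_lt s_in.
    exists (fun x => 0 + 0 * x) => // x; rewrite -s_in //.
  have [|h [_ [_ [Kh hphi _ _]]]] := hinge_interpolation Kaff Khinge supp s_lt.
    by apply: s0_ge0; rewrite -s_in mem_head.
  by exists h => // x; rewrite -s_in; apply: hphi.
have hu i : h (u i) = phi (u i).
  by apply: hphi; rewrite mem_cat map_f ?mem_enum.
have hv i : h (v i) = phi (v i).
  by apply: hphi; rewrite mem_cat orbC map_f ?mem_enum.
move: Kh; rewrite /K; under eq_bigr do rewrite hu.
by under [leRHS]eq_bigr do rewrite hv.
Qed.

End Karamata.

(** * Support lines of powers and of x ln x *)

Section SupportLines.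
Context (R : realType).
Implicit Types x y a : R.

(** Convexity of exp: the tangent at a x is compared with exp at x and at 0, with weights a and 1 -
    a. *)
Lemma expR_le_chord a x : 0 <= a <= 1 -> expR (a * x) <= 1 + a * (expR x - 1).
Proof.
move=> /andP[a0 a1].
have tangent z : expR (a * x) * (1 + (z - a * x)) <= expR z.
  rewrite -[in leRHS](subrKC (a * x) z) expRD ler_pM2l ?expR_gt0 //.
  exact: expR_ge1Dx.
have t1 := ler_wpM2l a0 (tangent x).
have a1' : 0 <= 1 - a by rewrite subr_ge0.
have := ler_wpM2l a1' (tangent 0); rewrite expR0; nra.
Qed.

(** Division by y^a leaves Bernoulli's inequality for x / y, which for x > 0 is the chord inequality
    at ln (x / y). *)
Lemma powR_tangent_le a x y : 0 < a -> a <= 1 -> 0 <= x -> 0 < y ->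
  x `^ a <= y `^ a + a * y `^ a / y * (x - y).
Proof.
move=> a0 a1 x0 y0; have yN0 : y != 0 by rewrite gt_eqF.
rewrite (_ : _ + _ = y `^ a * (1 + a * (x / y - 1))); last by field.
rewrite -[in leLHS](divfK yN0 x) mulrC powRM ?(ltW y0) ?divr_ge0 ?(ltW y0) //.
rewrite ler_pM2l ?powR_gt0 //.
have [->|xN0] := eqVneq x 0; first by rewrite mul0r powR0 ?gt_eqF //; lra.
have xy : 0 < x / y by rewrite divr_gt0 // lt_neqAle eq_sym xN0.
rewrite /powR gt_eqF // -[in leRHS](lnK xy).
by apply: expR_le_chord; rewrite (ltW a0).
Qed.

Lemma powR_tangent_ge a x y : 1 <= a -> 0 <= x -> 0 < y ->
  y `^ a + a * y `^ a / y * (x - y) <= x `^ a.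
Proof.
move=> a1 x0 y0; have yN0 : y != 0 by rewrite gt_eqF.
have a0 : 0 < a by apply: lt_le_trans a1.
rewrite (_ : _ + _ = y `^ a * (1 + a * (x / y - 1))); last by field.
rewrite -[in leRHS](divfK yN0 x) [x / y * y]mulrC.
rewrite powRM ?(ltW y0) ?divr_ge0 ?(ltW y0) //.
rewrite ler_pM2l ?powR_gt0 //.
have [->|xN0] := eqVneq x 0; first by rewrite mul0r powR0 ?gt_eqF //; lra.
have xy : 0 < x / y by rewrite divr_gt0 // lt_neqAle eq_sym xN0.
rewrite /powR gt_eqF // -[X in X - 1](lnK xy).
have av : 0 <= a^-1 <= 1 by rewrite invr_ge0 (ltW a0) invf_le1.
(* For a >= 1, Bernoulli's inequality is the chord inequality with factor 1 / a. *)
have := expR_le_chord (a * ln (x / y)) av.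
rewrite mulKf ?gt_eqF // => /(ler_wpM2l (ltW a0)).
by rewrite mulrDr mulr1 mulVKf ?gt_eqF //; lra.
Qed.

(** For x > 0 this is 1 + ln (y / x) <= y / x multiplied by x. *)
Lemma xlnx_tangent_ge x y : 0 <= x -> 0 < y ->
  y * ln y + (1 + ln y) * (x - y) <= x * ln x.
Proof.
move=> x0 y0; have [->|xN0] := eqVneq x 0; first by rewrite mul0r; nra.
have {}x0 : 0 < x by rewrite lt_neqAle eq_sym xN0.
have := expR_ge1Dx (ln (y / x)).
rewrite lnK ?posrE ?divr_gt0 // ln_div ?posrE // => /(ler_wpM2l (ltW x0)).
by rewrite mulrCA divff // mulr1; lra.
Qed.

End SupportLines.

(** * Schur-concavity of Renyi entropies *)

Section RenyiSchur.
Context (R : realType) (p : nat) (u v : 'F_p -> R).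
Context (uv : majorized u v).
Context (u0 : forall x, 0 <= u x) (v0 : forall x, 0 <= v x).
Context (u1 : \sum_x u x = 1).

Let sumr_gt0 (w : 'F_p -> R) (phi : R -> R) : \sum_x w x = 1 ->
  (forall x, 0 <= phi (w x)) -> (forall x, w x != 0 -> 0 < phi (w x)) ->
  0 < \sum_x phi (w x).
Proof.
move=> w1 phi0 phiw.
have [x wx] : exists x, w x != 0.
  apply/existsP; apply: contraT => /existsPn w0.
  by move: w1; rewrite big1 => [/esym/eqP|x _]; [rewrite oner_eq0 | apply/eqP/negPn].
by rewrite (bigD1 x) //= ltr_pwDl ?phiw // sumr_ge0.
Qed.

(** Karamata's inequality is used for t ln t at order 1, for t^a if a > 1 and for -t^a if 0 < a < 1,
    according to the sign of 1 / (1 - a). At order 0 the function is minus the indicator of t != 0,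
    with horizontal support lines; at infinite order singletons compare the maxima. *)
Lemma pmf_renyi_majorized (alpha : \bar R) : (0%E <= alpha)%E ->
  pmf_renyi alpha v <= pmf_renyi alpha u.
Proof.
have v1 : \sum_x v x = 1 by rewrite -uv.1.
case: alpha => [a| |] //=; rewrite ?lee_fin => a0.
- have [a_eq0|aN0] := eqVneq a 0.
    have cardE (w : 'F_p -> R) : #|support_set w|%:R = \sum_x (w x != 0)%:R :> R.
      rewrite -sumr_const big_mkcond; apply: eq_bigr => x _.
      by rewrite inE; case: ifP.
    have pos (w : 'F_p -> R) : \sum_x w x = 1 -> 0 < \sum_x (w x != 0)%:R :> R.
      by move=> w1; apply: (sumr_gt0 (phi := fun t => (t != 0)%:R) w1) => x //= ->.
    rewrite !cardE ler_ln ?posrE ?pos // -lerN2 -!sumrN.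
    apply: (majorized_convex (phi := fun t => - (t != 0)%:R) uv) => // y y0.
    exists 0 => x _; rewrite mul0r addr0 gt_eqF // lerN2.
    by case: (_ != _).
  have [a_eq1|aN1] := eqVneq a 1.
    rewrite lerN2; apply: (majorized_convex (phi := fun t => t * ln t) uv) => // y y0.
    by exists (1 + ln y) => x x0; apply: xlnx_tangent_ge.
  have {aN0}a0 : 0 < a by rewrite lt_neqAle eq_sym aN0.
  have pos (w : 'F_p -> R) :
      (forall x, 0 <= w x) -> \sum_x w x = 1 -> 0 < \sum_x w x `^ a.
    move=> w0 w1; apply: (sumr_gt0 (phi := fun t => t `^ a) w1) => x.
      exact: powR_ge0.
    by move=> wx; rewrite powR_gt0 // lt_neqAle eq_sym wx w0.
  have [a1|a1] := ltP 1 a.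
    rewrite ler_wnM2l //; first by rewrite invr_le0; lra.
    rewrite ler_ln ?posrE ?pos //.
    apply: (majorized_convex (phi := fun t => t `^ a) uv) => // y y0.
    by exists (a * y `^ a / y) => x x0; apply: powR_tangent_ge => //; apply: ltW.
  rewrite ler_wpM2l //; first by rewrite invr_ge0; lra.
  rewrite ler_ln ?posrE ?pos // -lerN2 -!sumrN.
  apply: (majorized_convex (phi := fun t => - t `^ a) uv) => // y y0.
  exists (- (a * y `^ a / y)) => x x0; rewrite mulNr -opprD lerN2.
  exact: powR_tangent_le.
have maxv_gt0 (w : 'F_p -> R) : \sum_x w x = 1 -> (forall x, 0 <= w x) ->
    0 < \big[Order.max/0]_x w x.
  move=> w1 w0; rewrite lt_neqAle bigmax_ge_id andbT eq_sym; apply/eqP => m0.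
  move: w1; rewrite big1 => [/esym/eqP|x _]; first by rewrite oner_eq0.
  by apply/le_anti; rewrite w0 andbT -m0 le_bigmax.
rewrite lerN2 ler_ln ?posrE ?maxv_gt0 //.
apply: bigmax_le => [|x _]; first exact: bigmax_ge_id.
have [D DC] := uv.2 [set x]%SET; rewrite big_set1.
rewrite cards1 in DC; have /cards1P[y ->] : #|D| == 1%N by apply/eqP.
by rewrite big_set1 => /le_trans; apply; apply: le_bigmax.
Qed.

End RenyiSchur.

(** * The law of a sum of independent variables *)

Local Open Scope classical_set_scope.
Local Open Scope ring_scope.

Lemma measure_bigcup_fintype (R : realFieldType) (d : measure_display)
    (T : ringOfSetsType d) (mu : {content set T -> \bar R}) (I : finType)
    (F : I -> set T) :
  (forall i, measurable (F i)) -> trivIset setT F ->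
  mu (\bigcup_i F i) = (\sum_i mu (F i))%E.
Proof.
move=> mF tF; rewrite measure_fin_bigcup //; last exact: finite_finset.
rewrite (_ : [set: I] = [set` index_enum I]).
  by rewrite -fsbig_seq // index_enum_uniq.
by apply/seteqP; split=> // i _ /=; rewrite mem_index_enum.
Qed.

Section SumOfIndependent.
Context (R : realType) (d : measure_display) (T : measurableType d)
  (P : probability T R) (p : nat).

Lemma measurable_preimage_Fp (Y : {RV P >-> 'F_p}) (A : set 'F_p) :
  measurable (Y @^-1` A).
Proof. by rewrite -[_ @^-1` _]setTI; apply: measurable_funPT. Qed.

Lemma pmf_ZpE (Y : {RV P >-> 'F_p}) (z : 'F_p) :
  P (Y @^-1` [set z]) = (pmf_Zp P Y z)%:E.
Proof.
rewrite /pmf_Zp fineK // fin_num_measure //.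
exact: measurable_preimage_Fp.
Qed.

Lemma sum_pmf_Zp (Y : {RV P >-> 'F_p}) : \sum_z pmf_Zp P Y z = 1.
Proof.
apply: EFin_inj; rewrite -sumEFin.
under eq_bigr do rewrite -pmf_ZpE.
rewrite -measure_bigcup_fintype.
- rewrite -(@probability_setT _ _ _ P); congr (P _).
  by apply/seteqP; split=> // w _; exists (Y w).
- by move=> z; apply: measurable_preimage_Fp.
by move=> z z' _ _ [w [<- <-]].
Qed.

Context (n : nat) (X : 'I_n -> {RV P >-> 'F_p}).
Context (X_indep : mutually_independent P (fun i => X i : T -> 'F_p)).
Context (a : 'I_n -> int).

Definition conv_pmf (r : seq 'I_n) : 'F_p -> R :=
  foldr (fun i f => dilated_conv (a i)%:~R (pmf_Zp P (X i)) f)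
    (fun z => (z == 0)%:R) r.

Let cylinder (r : seq 'I_n) (J : {set 'I_n}) (x : 'I_n -> 'F_p) (z : 'F_p) : set T :=
  [set w | \sum_(i <- r) X i w *~ a i = z] `&`
  \bigcap_(i in [set` J]) (X i @^-1` [set x i]).

Let measurable_cap (J : {set 'I_n}) (x : 'I_n -> 'F_p) :
  measurable (\bigcap_(i in [set` J]) (X i @^-1` [set x i])).
Proof. by apply: fin_bigcap_measurable => // i _; apply: measurable_preimage_Fp. Qed.

Let cylinder_cons i r (J : {set 'I_n}) x z : i \notin J ->
  cylinder (i :: r) J x z =
  \bigcup_(y in [set: 'F_p]) cylinder r (i |: J)%SET
     (fun k => if k == i then y else x k) (z - y *~ a i).
Proof.
move=> iJ; apply/seteqP; split=> w /=.
  rewrite /cylinder /= big_cons => -[<- xJ]; exists (X i w) => //=; split=> /=.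
    by rewrite addrAC subrr add0r.
  move=> k /=; rewrite !inE; case: eqVneq => [->//|_ /= kJ]; exact: xJ.
move=> [y _ [/= Sr xJ]]; split=> /=.
  rewrite big_cons Sr; have /= := xJ i; rewrite !inE eqxx => -> //.
  by rewrite addrC subrK.
move=> k /= kJ; have /= := xJ k; rewrite !inE kJ orbT => /(_ isT).
by case: eqVneq => // ki; move: iJ; rewrite -ki kJ.
Qed.

(** Splitting along the value of X_i moves i from the sum over r to the set J of prescribed values.
    When r is exhausted, mutual independence on J concludes. *)
Let prob_cylinder (r : seq 'I_n) (J : {set 'I_n}) (x : 'I_n -> 'F_p) (z : 'F_p) :
  uniq r -> (forall i, i \in r -> i \notin J) ->
  measurable (cylinder r J x z) /\
  P (cylinder r J x z) =
    (conv_pmf r z * \prod_(i in J) pmf_Zp P (X i) (x i))%:E.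
Proof.
elim: r J x z => [|i r IH] J x z /=.
  move=> _ _; rewrite /cylinder; have [->|z0] := eqVneq z 0.
    rewrite (_ : [set _ | _] = setT) ?setTI; last first.
      by apply/seteqP; split=> // w _ /=; rewrite big_nil.
    rewrite mul1r; split; first exact: measurable_cap.
    rewrite (X_indep (B := fun i => [set x i])) // -prodEFin.
    by apply: eq_bigr => i _; rewrite pmf_ZpE.
  rewrite (_ : [set _ | _] = set0) ?set0I; last first.
    apply/seteqP; split=> // w /=; rewrite big_nil => /esym z0'.
    by rewrite z0' eqxx in z0.
  by rewrite mul0r measure0; split=> //; exact: measurable0.
move=> /andP[ir r_uniq] rJ; have iJ := rJ i (mem_head _ _).
have rJ' k : k \in r -> k \notin (i |: J)%SET.
  move=> kr; rewrite !inE negb_or rJ ?in_cons ?kr ?orbT // andbT.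
  by apply: contraNneq ir => <-.
have step y := IH (i |: J)%SET (fun k => if k == i then y else x k) (z - y *~ a i)
  r_uniq rJ'.
rewrite cylinder_cons //; split.
  by apply: fin_bigcup_measurable => // y _; have [] := step y.
rewrite measure_bigcup_fintype //.
- transitivity (\sum_(y : 'F_p) (conv_pmf r (z - y *~ a i) *
    \prod_(k in (i |: J)%SET) pmf_Zp P (X k) (if k == i then y else x k))%:E)%E.
    by apply: eq_bigr => y _; exact: (step y).2.
  rewrite sumEFin; congr EFin; rewrite /dilated_conv mulr_suml.
  apply: eq_bigr => y _; rewrite big_setU1 //= eqxx mulrzr.
  rewrite mulrCA mulrA; congr (_ * _); apply: eq_bigr => k kJ.
  by case: eqVneq => // ki; rewrite -ki kJ in iJ.
- by move=> y; have [] := step y.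
- move=> y y' _ _ [w [[_ /(_ i) /= xJ] [_ /(_ i) /= xJ']]].
  by move: xJ xJ'; rewrite !inE eqxx => <- // <-.
Qed.

Lemma pmf_sum_independent :
  pmf_Zp P (fun w => \sum_(i < n) X i w *~ a i) = conv_pmf (index_enum 'I_n).
Proof.
apply/funext => z; rewrite /pmf_Zp.
have [|_] := @prob_cylinder _ finset.set0 (fun=> 0) z (index_enum_uniq 'I_n).
  by move=> i; rewrite inE.
rewrite big_set0 mulr1 /cylinder (_ : \bigcap_(_ in _) _ = setT) ?setIT; last first.
  by apply/seteqP; split=> // w _ i /=; rewrite inE.
by move=> ->.
Qed.

End SumOfIndependent.

(* a_nz is needed in addition to a != 0: with a_i = 0 in Z/pZ for some i the
   inequality fails, e.g. for n = 1 and a = (p). *)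
Theorem theorem4p2 (R : realType) (d : measure_display)
    (T : measurableType d) (P : probability T R)
    (p : nat) (p_prime : prime p) (p_ge3 : (3 <= p)%N)
    (alpha : \bar R) (alpha_ge0 : (0%E <= alpha)%E)
    (n : nat) (X : 'I_n -> {RV P >-> 'F_p})
    (X_indep : mutually_independent P (fun i => X i : T -> 'F_p))
    (X_regular : forall i, triangle_regular (pmf_Zp P (X i)) \/
                           square_regular (pmf_Zp P (X i)))
    (X_rearr : forall i,
       [\/ triangle_regular (pmf_Zp P (X i)) /\
             pmf_Zp P (X i) = rearr_star (pmf_Zp P (X i)),
           pmf_Zp P (X i) = rearr_plus (pmf_Zp P (X i)) |
           pmf_Zp P (X i) = rearr_minus (pmf_Zp P (X i))])
    (a : 'rV[int]_n) (a_neq0 : a != 0)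
    (a_nz : forall i, ~~ (p %| a ord0 i)%Z) :
  renyi_entropy P alpha (fun w => \sum_(i < n) X i w *~ a ord0 i) >=
  renyi_entropy P alpha (fun w => \sum_(i < n) X i w).
Proof.
rewrite /renyi_entropy.
pose f i := pmf_Zp P (X i).
have tri i : signed_triangle (f i).
  have fE : f i =1 rearr_plus (f i) \/ f i =1 rearr_minus (f i).
    case: (X_rearr i) => [[_ fi]|fi|fi]; [left|left|right] => y;
    by rewrite [in LHS]/f [in LHS]fi.
  have [ftri|fsq] := X_regular i; last exact: square_regular_signed.
  apply: triangle_regular_signed => // y.
  by case: fE => fE; rewrite fE //; apply/esym/ftri.
have a_Fp i : (a ord0 i)%:~R != 0 :> 'F_p.
  by rewrite -(dvdz_pcharf (pchar_Fp p_prime)).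
have f_ge0 Y z : 0 <= pmf_Zp P (Y : T -> 'F_p) z by rewrite fine_ge0.
(* Both laws are iterated convolutions of the same [f i], with dilations a_i and 1; domination
   passes through one factor at a time, starting from the point mass at 0. *)
have dom (r : seq 'I_n) :
    signed_dominated (conv_pmf X (fun i => a ord0 i) r) (conv_pmf X (fun=> 1) r).
  elim: r => [|i r IH]; first exact: signed_dominated_delta.
  by have := signed_dominated_dilated_conv p_prime p_ge3 (a_Fp i) (tri i) IH.
have -> : (fun w => \sum_(i < n) X i w) =
    (fun w => \sum_(i < n) X i w *~ 1) :> (T -> 'F_p).
  by [].
rewrite !pmf_sum_independent //.
have := dom (index_enum 'I_n) => /(signed_dominated_majorized p_prime) maj.
apply: pmf_renyi_majorized => //.
- by move=> z; rewrite -pmf_sum_independent.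
- by move=> z; rewrite -pmf_sum_independent.
suff total r : \sum_z conv_pmf X (fun i => a ord0 i) r z = 1 by [].
elim: r => [|i r IH] /=.
  by rewrite (bigD1 0) //= big1 ?addr0 // => y /negPf->.
by rewrite sum_dilated_conv IH sum_pmf_Zp mulr1.
Qed.
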